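(* Let $A$ be a reversible element of $\mathrm{SL}(n,\mathbb{C})$. Let $s$ denote the number of Jordan blocks of the form $\mathrm{J}(\mu,4k+2)$, with $\mu\in\{-1,+1\}$ and $k\ge 0$ an integer, in the Jordan decomposition of $A$ (counted with multiplicity). Let $t$ denote the number of pairs of the form $\{\mathrm{J}(\lambda,2m+1),\mathrm{J}(\lambda^{-1},2m+1)\}$, with $\lambda\notin\{-1,+1\}$ and $m\ge 0$ an integer, in the Jordan decomposition of $A$ (counted with multiplicity). Then $A$ is strongly reversible in $\mathrm{SL}(n,\mathbb{C})$ if and only if at least one of the following conditions holds. (1) There is a Jordan block $\mathrm{J}(\mu,2r+1)$, $\mu\in\{-1,+1\}$, of odd size in the Jordan decomposition of $A$. (2) $s+t\equiv 0 \pmod 2$.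
   Context: $\mathrm{J}(\lambda,m)$ denotes the $m\times m$ Jordan block with $\lambda$ on the diagonal, $1$ on the super-diagonal and $0$ elsewhere. An element $g$ of a group $G$ is an involution if $g^2=e$ (so $e$ itself counts). An element $g\in G$ is reversible in $G$ if $hgh^{-1}=g^{-1}$ for some $h\in G$, and strongly reversible in $G$ if it is a product of two involutions of $G$ (equivalently, $hgh^{-1}=g^{-1}$ for some involution $h\in G$). For a reversible $A\in\mathrm{SL}(n,\mathbb{C})$, the Jordan blocks of $A$ can be partitioned into singletons $\{\mathrm{J}(\mu,k)\}$ with $\mu\in\{-1,+1\}$ and pairs $\{\mathrm{J}(\lambda,m),\mathrm{J}(\lambda^{-1},m)\}$ with $\lambda\in\mathbb{C}\setminus\{-1,0,+1\}$; the pairs counted by $t$ are those of this partition with $m$ odd, so $2t$ is the number of Jordan blocks of $A$ of odd size whose eigenvalue is not $\pm1$. *)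

(* Defs.v *)
From HB Require Import structures.
From mathcomp Require Import all_boot all_order all_fingroup all_algebra.
From mathcomp Require Import complex reals.
Set Implicit Arguments. Unset Strict Implicit. Unset Printing Implicit Defensive.
Import GRing.Theory.
Local Open Scope ring_scope.

Section Reversibility.
Variable G : groupType.
Implicit Types g h : G.
Local Open Scope group_scope.

(* The identity is an involution. *)
Definition involution g : Prop := g * g = 1.

Definition reversible g : Prop := exists h, h * g * h^-1 = g^-1.

Definition strongly_reversible g : Prop :=
  exists h1 h2, [/\ involution h1, involution h2 & g = h1 * h2].

End Reversibility.

Section SpecialLinear.
Variables (n : nat) (F : fieldType).

Record SL := MkSL { SLval :> 'M[F]_n ; _ : \det SLval == 1 }.

HB.instance Definition _ := [isSub for SLval].
HB.instance Definition _ := [Choice of SL by <:].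

Fact det_SL (A : SL) : \det A = 1.
Proof. by apply/eqP; case: A. Qed.

Fact SL_unitmx (A : SL) : (A : 'M_n) \in unitmx.
Proof. by rewrite unitmxE det_SL unitr1. Qed.

Fact SL_one_subproof : \det (1%:M : 'M[F]_n) == 1.
Proof. by rewrite det1. Qed.

Fact SL_mul_subproof (A B : SL) : \det ((A : 'M_n) *m B) == 1.
Proof. by rewrite det_mulmx !det_SL mulr1. Qed.

Fact SL_inv_subproof (A : SL) : \det (invmx (A : 'M_n)) == 1.
Proof. by rewrite det_inv det_SL invr1. Qed.

Definition SL_one := MkSL SL_one_subproof.
Definition SL_mul A B := MkSL (SL_mul_subproof A B).
Definition SL_inv A := MkSL (SL_inv_subproof A).

Fact SL_mulA : associative SL_mul.
Proof. by move=> A B D; apply/val_inj/mulmxA. Qed.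

Fact SL_mul1 : left_id SL_one SL_mul.
Proof. by move=> A; apply/val_inj/mul1mx. Qed.

Fact SL_mulr1 : right_id SL_one SL_mul.
Proof. by move=> A; apply/val_inj/mulmx1. Qed.

Fact SL_mulV : left_inverse SL_one SL_inv SL_mul.
Proof. by move=> A; apply/val_inj/mulVmx/SL_unitmx. Qed.

Fact SL_mulrV : right_inverse SL_one SL_inv SL_mul.
Proof. by move=> A; apply/val_inj/mulmxV/SL_unitmx. Qed.

HB.instance Definition _ :=
  isGroup.Build SL SL_mulA SL_mul1 SL_mulr1 SL_mulV SL_mulrV.

End SpecialLinear.

Section Jordan.
Variable F : fieldType.

Definition jordan_block (lambda : F) (m : nat) : 'M[F]_m :=
  \matrix_(i, j) (if i == j then lambda else if j == i.+1 :> nat then 1 else 0).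

(* A Jordan block J(lambda, m) is encoded by the pair (lambda, m), and a       *)
(* Jordan matrix by the sequence of its diagonal blocks.                       *)
Implicit Type js : seq (F * nat).

Definition jordan_size js (i : 'I_(size js)) : nat := (tnth (in_tuple js) i).2.

Definition jordan_mx js : 'M[F]_(\sum_(i < size js) jordan_size i) :=
  \mxdiag_(i < size js) jordan_block (tnth (in_tuple js) i).1 (jordan_size i).

(* Empty blocks are excluded, so that js is determined by A up to permutation. *)
Definition jordan_decomposition n (A : 'M[F]_n) js : Prop :=
  all (fun b => 0 < b.2)%N js /\
  exists (e : (\sum_(i < size js) jordan_size i)%N = n) (P : 'M[F]_n),
    P \in unitmx /\ A = P *m castmx (e, e) (jordan_mx js) *m invmx P.

Definition pm1 (lambda : F) : bool := (lambda == 1) || (lambda == -1).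

Definition num_pm1_2mod4 js : nat :=
  count (fun b => pm1 b.1 && (b.2 %% 4 == 2)%N) js.

(* Each pair {J(lambda, m), J(lambda^-1, m)} contributes two blocks, hence the *)
(* halving; see num_odd_pairsE.                                                *)
Definition num_odd_pairs js : nat :=
  (count (fun b => ~~ pm1 b.1 && odd b.2) js)./2.

Definition inverse_pair (b : F * nat) : seq (F * nat) := [:: b; (b.1^-1, b.2)].

Definition jordan_pairing js (singles pairs : seq (F * nat)) : Prop :=
  [/\ all (fun b => pm1 b.1) singles,
      all (fun b => (b.1 != 0) && ~~ pm1 b.1) pairs
    & perm_eq js (singles ++ flatten (map inverse_pair pairs))].

Lemma num_odd_pairsE js singles pairs : jordan_pairing js singles pairs ->
  num_odd_pairs js = count (fun b => odd b.2) pairs.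
Proof.
case=> sP pP /seq.permP js_eq; rewrite /num_odd_pairs js_eq count_cat.
have -> : count (fun b => ~~ pm1 b.1 && odd b.2) singles = 0%N.
  by elim: singles sP {js_eq} => //= b s IHs /andP[-> /IHs->].
rewrite add0n -[RHS]doubleK; congr _./2.
elim: pairs pP {js_eq} => //= b s IHs /andP[/andP[_ bN1] /IHs->].
have bVN1 : ~~ pm1 b.1^-1 by rewrite /pm1 (can2_eq invrK invrK) invr1
  (can2_eq invrK invrK) invrN1.
by rewrite bN1 bVN1 /= doubleD addnA addnn; case: (odd _).
Qed.

End Jordan.

(* Main.v *)
Require Import Defs.
From mathcomp Require Import all_boot all_order all_fingroup all_algebra.
From mathcomp Require Import complex reals ring.
Set Implicit Arguments. Unset Strict Implicit. Unset Printing Implicit Defensive.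
Import GRing.Theory Num.Theory.
Local Open Scope ring_scope.

(** A is strongly reversible in SL(n) exactly when some h with h h = 1,
    A h A = h and det h = 1 exists (take A = (A h) h), so the question is which
    signs the determinant of an involution h reversing A can take.

    An involution has determinant (-1)^d with tr h = n - 2 d
    (det_involution), so its trace decides. In a Jordan basis, the diagonal
    block c of h at a block J = J(l, m) of A satisfies J c J = c. Comparing
    entries, c = 0 when l^2 != 1, while for l = 1 or -1 the block c is upper
    triangular with diagonal x, -x, x, and so on; hence tr c = 0 unless
    l = 1 or -1 and m is odd (jordan_fixed_eq0, jordan_fixed_tr0). If A has no
    block of odd size with eigenvalue 1 or -1, every reversing involution thus
    has trace 0 and determinant (-1)^(n/2). Counting sizes modulo 4, with the
    other blocks paired, gives n/2 = s + t modulo 2 (half_size_parity).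

    Conversely a reversing involution of GL(n) always exists. The Jordan blocks
    of A are permuted by an involution tau carrying (l, m) to (l^-1, m), because
    the ranks of (A - l)^k determine the blocks and A is conjugate to its
    inverse. Each block is sent to its tau-image by a signed, weighted Pascal
    matrix S_l for which J(l^-1) S_l J(l) = S_l and S_(l^-1) S_l = 1. If the
    block i0 has odd size and eigenvalue 1 or -1, then tau fixes i0 and changing
    the sign of h on that block flips the determinant, so both signs occur. *)

(** * The determinant of an involution *)

Section InvolutionDeterminant.
Variable F : fieldType.

(** Both determinants are that of the block matrix with rows (1, C), (R, 1),
    eliminated in the two possible orders. *)
Lemma det_1subM n r (C : 'M[F]_(n, r)) (R : 'M_(r, n)) :
  \det (1%:M - C *m R) = \det (1%:M - R *m C).
Proof.
have : block_mx (1%:M - C *m R) C 0 1%:M *m block_mx 1%:M 0 R 1%:M =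
       block_mx 1%:M 0 R 1%:M *m block_mx 1%:M C 0 (1%:M - R *m C).
  rewrite !mulmx_block !(mulmx0, mul0mx, mulmx1, mul1mx, addr0, add0r).
  by rewrite subrK [_ + (1%:M - _)]addrC subrK.
move/(congr1 determinant); rewrite !det_mulmx !det_ublock !det_lblock !det1.
by rewrite !mulr1 !mul1r.
Qed.

(** In a full rank factorization E = C R, the factor C cancels on the left and R
    on the right, so E E = E leaves R C = 1. *)
Lemma idempotent_split n (E : 'M[F]_n) : E *m E = E ->
  exists r (C : 'M[F]_(n, r)) (R : 'M[F]_(r, n)), C *m R = E /\ R *m C = 1%:M.
Proof.
move=> EE; exists (\rank E), (col_base E), (row_base E); split.
  exact: mulmx_base.
have key : col_base E *m (row_base E *m col_base E *m row_base E) =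
             col_base E *m (1%:M *m row_base E).
  by rewrite mul1mx -(mulmxA (row_base E)) mulmx_base (mulmxA (col_base E)) mulmx_base.
by have/row_free_inj := row_full_inj (col_base_full E) key; apply; exact: row_base_free.
Qed.

(** Writing h = 1 - 2 E with E idempotent of rank d, both the trace and the
    determinant reduce to those of a d x d matrix by cycling the factors
    of E. *)
Lemma det_involution n (h : 'M[F]_n) : 2%:R != 0 :> F -> h *m h = 1%:M ->
  exists d : nat, \tr h + d.*2%:R = n%:R /\ \det h = (-1) ^+ d.
Proof.
move=> nz2 hh; pose E := 2%:R^-1 *: (1%:M - h).
have hE : h = 1%:M - 2%:R *: E.
  by rewrite /E scalerA mulfV // scale1r opprB addrC subrK.
have EE : E *m E = E.
  rewrite /E -scalemxAl -scalemxAr mulmxBl mul1mx mulmxBr mulmx1 hh.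
  have -> : 1%:M - h - (h - 1%:M) = 2%:R *: (1%:M - h).
    by rewrite opprB scaler_nat mulr2n.
  by rewrite !scalerA -mulrA mulVf ?mulr1.
have [d [C [R [CR RC]]]] := idempotent_split EE.
exists d; rewrite hE -CR; split.
  rewrite raddfB /= mxtrace1 mxtraceZ mxtrace_mulC RC mxtrace1 -natrM mul2n.
  by rewrite subrK.
rewrite scalemxAl det_1subM -scalemxAr RC -[1%:M in X in X - _]scale1r.
by rewrite -scalerBl (_ : 1 - 2%:R = -1) ?detZ ?det1 ?mulr1 // mulr2n opprD addNKr.
Qed.

End InvolutionDeterminant.

(** * Jordan blocks, entry by entry *)

Section JordanBlocks.
Variable F : fieldType.

Definition shift_mx m : 'M[F]_m := \matrix_(i, j) (j == i.+1 :> nat)%:R.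

Lemma jordan_blockE (a : F) m : jordan_block a m = a%:M + shift_mx m.
Proof.
apply/matrixP => i j; rewrite !mxE; case: (eqVneq i j) => [->|_].
  by rewrite mulr1n (ltn_eqF (ltnSn j)) addr0.
by rewrite mulr0n add0r; case: eqP.
Qed.

(** Reading a matrix as zero outside its range turns multiplication by a shift
    into a translation of indices, without boundary cases in the recurrences. *)
Definition entry p q (c : 'M[F]_(p, q)) (i j : nat) : F :=
  if insub i is Some a then if insub j is Some b then c a b else 0 else 0.

Lemma entry_ord p q (c : 'M[F]_(p, q)) (i : 'I_p) (j : 'I_q) :
  entry c i j = c i j.
Proof. by rewrite /entry !valK. Qed.

Lemma entry_outl p q (c : 'M[F]_(p, q)) i j : (p <= i)%N -> entry c i j = 0.
Proof. by rewrite leqNgt /entry => ip; case: insubP => // a; rewrite (negPf ip). Qed.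

Lemma entry_outr p q (c : 'M[F]_(p, q)) i j : (q <= j)%N -> entry c i j = 0.
Proof.
rewrite leqNgt /entry => jq; case: insubP => // a _ _.
by case: insubP => // b; rewrite (negPf jq).
Qed.

Lemma entry_shiftl p q (c : 'M[F]_(p, q)) i j :
  entry (shift_mx p *m c) i j = if (i < p)%N then entry c i.+1 j else 0.
Proof.
have [ip|pi] := ltnP i p; last by rewrite entry_outl.
have [jq|qj] := ltnP j q; last by rewrite !entry_outr.
have -> := entry_ord (shift_mx p *m c) (Ordinal ip) (Ordinal jq); rewrite mxE.
have [i1p|pi1] := ltnP i.+1 p.
  rewrite (bigD1 (Ordinal i1p)) //= mxE eqxx mul1r big1 ?addr0.
    by rewrite -[LHS](entry_ord c (Ordinal i1p) (Ordinal jq)).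
  by move=> k /eqP ne; rewrite mxE; case: eqP => [e|_]; rewrite ?mul0r //;
     case: ne; apply: val_inj.
rewrite entry_outl // big1 // => k _.
by rewrite mxE ltn_eqF ?mul0r //= (leq_trans (ltn_ord k)).
Qed.

Lemma entry_shiftr p q (c : 'M[F]_(p, q)) i j : (j < q)%N ->
  entry (c *m shift_mx q) i j = if j is j'.+1 then entry c i j' else 0.
Proof.
move=> jq; have [ip|pi] := ltnP i p; last first.
  by case: j jq => [|j] jq; rewrite !entry_outl.
have -> := entry_ord (c *m shift_mx q) (Ordinal ip) (Ordinal jq); rewrite mxE.
case: j jq => [|j] jq; first by rewrite big1 // => k _; rewrite mxE mulr0.
rewrite (bigD1 (Ordinal (ltnW jq))) //= mxE eqxx mulr1 big1 ?addr0.
  by rewrite -[LHS](entry_ord c (Ordinal ip) (Ordinal (ltnW jq))).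
move=> k /eqP ne; rewrite mxE eqSS; case: eqP => [e|_]; rewrite ?mulr0 //.
by case: ne; apply: val_inj.
Qed.

Lemma entry0 p q i j : entry (0 : 'M[F]_(p, q)) i j = 0.
Proof.
rewrite /entry; case: insub => [a|] //.
by case: insub => [b|]; rewrite ?mxE.
Qed.

Lemma entryD p q (c d : 'M[F]_(p, q)) i j :
  entry (c + d) i j = entry c i j + entry d i j.
Proof.
rewrite /entry; case: insub => [a|]; last by rewrite addr0.
by case: insub => [b|]; rewrite ?mxE ?addr0.
Qed.

Lemma entryZ p q a (c : 'M[F]_(p, q)) i j : entry (a *: c) i j = a * entry c i j.
Proof.
rewrite /entry; case: insub => [x|]; last by rewrite mulr0.
by case: insub => [y|]; rewrite ?mxE ?mulr0.
Qed.

Lemma entryP p q (c d : 'M[F]_(p, q)) :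
  (forall i j, (i < p)%N -> (j < q)%N -> entry c i j = entry d i j) -> c = d.
Proof. by move=> e; apply/matrixP=> i j; rewrite -!entry_ord e. Qed.

(** Both the vanishing of traces and the construction of reversing matrices
    come from the matrices fixed by c |-> J(a) c J(b); this recurrence on entries
    describes them. *)
Lemma entry_jordan_sandwich p q (a b : F) (c : 'M[F]_(p, q)) i j :
    (i < p)%N -> (j < q)%N ->
  entry (jordan_block a p *m c *m jordan_block b q) i j =
    a * b * entry c i j + b * entry c i.+1 j +
    (if j is j'.+1 then a * entry c i j' + entry c i.+1 j' else 0).
Proof.
move=> ip jq; rewrite !jordan_blockE mulmxDr entryD entry_shiftr //.
rewrite mul_mx_scalar entryZ !mulmxDl mul_scalar_mx.
case: j jq => [|j] jq; rewrite !entryD !entryZ !entry_shiftl ip;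
by rewrite mulrDr mulrA [b * a]mulrC.
Qed.

End JordanBlocks.

(** * Matrices intertwining a Jordan block with an inverse *)

Section Reversers.
Variable F : fieldType.
Implicit Types (a l : F) (m p q r : nat).

(** The coefficient l^2 - 1 of the (i, j) entry in the recurrence is nonzero, so
    that entry is determined by entries further down or to the left; the zero
    border then spreads over the whole matrix. *)
Lemma jordan_fixed_eq0 l m (c : 'M[F]_m) : l * l != 1 ->
  jordan_block l m *m c *m jordan_block l m = c -> c = 0.
Proof.
move=> l2 /(congr1 (@entry F m m)) fix_c.
suff c0 j : forall k i, (m <= i + k)%N -> entry c i j = 0.
  by apply/matrixP=> i j; rewrite -entry_ord mxE (c0 _ m) ?leq_addl.
elim: j => [|j IHj]; elim=> [|k IHk] i.
- by rewrite addn0 => /entry_outl->.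
- move=> mik; have [im|/entry_outl->//] := ltnP i m.
  have [jm|/entry_outr->//] := ltnP 0 m.
  have := congr1 (fun f => f i 0%N) fix_c; rewrite /= entry_jordan_sandwich //.
  rewrite (IHk i.+1) ?addSnnS // mulr0 !addr0 => /eqP.
  by rewrite -[X in _ == X]mul1r -subr_eq0 -mulrBl mulf_eq0 subr_eq0 (negPf l2)
     => /eqP.
- by rewrite addn0 => /entry_outl->.
move=> mik; have [im|/entry_outl->//] := ltnP i m.
have [jm|/entry_outr->//] := ltnP j.+1 m.
have := congr1 (fun f => f i j.+1) fix_c; rewrite /= entry_jordan_sandwich //.
rewrite (IHk i.+1) ?addSnnS // !(IHj m) ?leq_addl // !mulr0 !addr0 => /eqP.
by rewrite -[X in _ == X]mul1r -subr_eq0 -mulrBl mulf_eq0 subr_eq0 (negPf l2)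
   => /eqP.
Qed.

Lemma sum_alternating m : ~~ odd m -> \sum_(i < m) (-1) ^+ i = 0 :> F.
Proof.
move=> m_even; rewrite -[m]odd_double_half (negPf m_even) add0n.
elim: m./2 => [|k IHk]; first by rewrite big_ord0.
by rewrite doubleS !big_ord_recr /= IHk exprS mulN1r add0r subrr.
Qed.

(** When l^2 = 1 the (i, j) entry drops out of the recurrence. What remains forces
    zeros below the diagonal, starting from the first column, and alternating
    signs along the diagonal. *)
Lemma jordan_fixed_tr0 l m (c : 'M[F]_m) : l * l = 1 -> ~~ odd m ->
  jordan_block l m *m c *m jordan_block l m = c -> \tr c = 0.
Proof.
move=> l2 m_even /(congr1 (@entry F m m)) fix_c.
have l_nz : l != 0 by apply: contra_eqN l2 => /eqP->; rewrite mul0r eq_sym oner_eq0.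
have rec i j : (i < m)%N -> (j < m)%N ->
    l * entry c i.+1 j +
    (if j is j'.+1 then l * entry c i j' + entry c i.+1 j' else 0) = 0.
  move=> im jm; have := congr1 (fun f => f i j) fix_c.
  rewrite /= entry_jordan_sandwich // l2 mul1r -addrA.
  by rewrite -[X in _ = X]addr0 => /addrI.
have upper j : forall i, (j < i)%N -> entry c i j = 0.
  elim: j => [|j IHj] [|i] // ji; have [im|/leqW mi] := ltnP i m;
    try by rewrite entry_outl.
  - have := rec i 0%N im (leq_ltn_trans (leq0n _) im); rewrite addr0 => /eqP.
    by rewrite mulf_eq0 (negPf l_nz) => /eqP.
  - have := rec i j.+1 im (leq_trans ji im).
    rewrite IHj // IHj 1?ltnW // mulr0 !addr0 => /eqP.
    by rewrite mulf_eq0 (negPf l_nz) => /eqP.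
have diag i : (i < m)%N -> entry c i i = (-1) ^+ i * entry c 0 0.
  elim: i => [|i IHi] im; first by rewrite mul1r.
  (* The recurrence just above the diagonal links two consecutive diagonal
     entries, its third term being below the diagonal. *)
  have := rec i i.+1 (ltnW im) im; rewrite (upper i i.+1) // addr0 -mulrDr.
  move/eqP; rewrite mulf_eq0 (negPf l_nz) addr_eq0 => /eqP->.
  by rewrite IHi 1?ltnW // exprS mulN1r mulNr.
rewrite /mxtrace (eq_bigr (fun i : 'I_m => (-1) ^+ i * entry c 0 0)); last first.
  by move=> i _; rewrite -entry_ord diag.
by rewrite -mulr_suml sum_alternating ?mul0r.
Qed.

(** On polynomials f modulo x^m, with rows holding the coefficients, the shift is
    multiplication by x, and a reversing map is f |-> w * (f o phi) where
    (l + x) (l^-1 + phi) = 1. Taking the weight w = l / (l + x) gives the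
    coefficients below. The dimensions p and q are independent because the
    sizes of paired blocks are only propositionally equal. *)
Definition pascal_mx l p q : 'M[F]_(p, q) :=
  \matrix_(i, j) ((-1) ^+ j * l ^- (i + j) * 'C(j, i)%:R).

Lemma entry_pascal l p i j : (j < p)%N ->
  entry (pascal_mx l p p) i j = (-1) ^+ j * l ^- (i + j) * 'C(j, i)%:R.
Proof.
move=> jp; have [ip|pi] := ltnP i p.
  by have -> := entry_ord (pascal_mx l p p) (Ordinal ip) (Ordinal jp); rewrite mxE.
by rewrite entry_outl // bin_small ?mulr0 // (leq_trans jp).
Qed.

(** The recurrence satisfied by the entries is the Pascal rule. *)
Lemma pascal_mx_reverses l p q : p = q -> l != 0 ->
  jordan_block l^-1 p *m pascal_mx l p q *m jordan_block l q = pascal_mx l p q.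
Proof.
move=> <- l0; apply: entryP => i j ip jp.
rewrite entry_jordan_sandwich // mulVf // mul1r -addrA.
rewrite -[RHS]addr0; congr (_ + _).
case: j jp => [|j] jp; rewrite !entry_pascal ?(ltnW jp) //.
  by rewrite bin0n !mulr0 addr0.
rewrite binS natrD !addSn !addnS !exprS !invfM.
by field; rewrite l0 ?expf_neq0.
Qed.

Lemma coef_1DXn j i : ((1 + 'X) ^+ j : {poly F})`_i = 'C(j, i)%:R.
Proof.
rewrite exprDn coef_sum (eq_bigr (fun l : 'I_j.+1 => ('C(j, i)%:R : F) *+ (i == l))).
  have [ij|ji] := ltnP i j.+1.
    rewrite (bigD1 (Ordinal ij)) //= eqxx big1 ?addr0 // => l ne.
    by rewrite eq_sym -[ i ]/(val (Ordinal ij)) val_eqE (negPf ne).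
  by rewrite bin_small // big1 // => l _; rewrite mul0rn.
move=> l _; rewrite expr1n mul1r coefMn coefXn; case: eqP => [->|_] //.
by rewrite mulr0n mul0rn.
Qed.

(** The coefficient of X^i in (1 - (1 + X))^k = (- X)^k, expanded by the binomial
    theorem in two ways. *)
Lemma sum_bin_sign m i k : (k < m)%N ->
  \sum_(j < m) (-1) ^+ j * 'C(k, j)%:R * 'C(j, i)%:R =
    (-1) ^+ k * (i == k)%:R :> F.
Proof.
move=> km; have := congr1 (fun u : {poly F} => u`_i) (exprDn 1 (- (1 + 'X)) k).
rewrite {1}opprD addrA subrr add0r -scaleN1r exprZn.
rewrite coefZ coefXn => ->; rewrite coef_sum [RHS](big_ord_widen _ (fun j =>
   ((1 ^+ (k - j) * (- (1 + 'X)) ^+ j) *+ 'C(k, j))`_i) km) [RHS]big_mkcond /=.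
apply: eq_bigr => j _; case: ltnP => kj; last first.
  by rewrite (bin_small kj) mulr0 mul0r.
rewrite expr1n mul1r coefMn -scaleN1r exprZn coefZ coef_1DXn.
by rewrite -[RHS]mulr_natr mulrAC.
Qed.

(** The substitutions phi for l and for l^-1 are inverse to each other, and the
    weight for one, composed with the other, gives the inverse weight. *)
Lemma pascal_mxK l p q r : p = q -> q = r -> l != 0 ->
  pascal_mx l^-1 p q *m pascal_mx l q r = \matrix_(i, j) (i == j :> nat)%:R.
Proof.
move=> <- <- l0; apply/matrixP=> i k; rewrite !mxE.
transitivity (l ^+ i * l ^- k * (-1) ^+ k *
   \sum_(j < p) (-1) ^+ j * 'C(k, j)%:R * 'C(j, i)%:R).
  rewrite mulr_sumr; apply: eq_bigr => j _; rewrite !mxE !exprVn !exprD.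
  by field; rewrite !expf_neq0 ?oner_eq0.
rewrite sum_bin_sign //; case: eqP => [->|_]; last by rewrite !mulr0.
by rewrite mulr1 divff ?expf_neq0 // mul1r -exprD addnn -signr_odd odd_double.
Qed.

End Reversers.

(** * Ranks of powers and the number of Jordan blocks *)

Section JordanRank.
Variable F : fieldType.
Implicit Types (a l : F) (m k : nat).

Lemma det_jordan_block l m : \det (jordan_block l m) = l ^+ m.
Proof.
rewrite -det_tr det_trig; last first.
  by apply/is_trig_mxP => i j ij; rewrite !mxE -val_eqE gtn_eqF // ltn_eqF // ltnW.
rewrite (eq_bigr (fun=> l)) ?prodr_const ?card_ord // => i _.
by rewrite !mxE eqxx.
Qed.

Lemma jordan_blockB l a m : jordan_block l m - a%:M = jordan_block (l - a) m.
Proof. by rewrite !jordan_blockE raddfB /= addrAC. Qed.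

Lemma entry_shiftX m k i j : (j < m)%N ->
  entry (shift_mx F m ^+ k) i j = (j == i + k)%N%:R.
Proof.
move=> jm; elim: k i => [|k IHk] i; have [im|mi] := ltnP i m; try first
  [by rewrite entry_outl // ltn_eqF // (leq_trans jm) // (leq_trans mi) // leq_addr].
  have -> := entry_ord (1%:M : 'M[F]_m) (Ordinal im) (Ordinal jm).
  by rewrite mxE addn0 eq_sym.
by rewrite exprS entry_shiftl im IHk addSnnS.
Qed.

(** The lower bound comes from an identity submatrix of size m - k. Applied to
    k and m - k when k <= m, it is sharp because the product of the two powers
    is zero. *)
Lemma rank_shiftX m k : \rank (shift_mx F m ^+ k) = (m - k)%N.
Proof.
have rank_geq n : (m - n <= \rank (shift_mx F m ^+ n))%N.
  apply: (@mulmx1_min_rank _ _ _ _ _ (\matrix_(i, j) (j == i :> nat)%:R)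
    (\matrix_(i, j) (i == j + n :> nat)%N%:R)).
  apply/matrixP=> i j; rewrite -mulmxA !mxE.
  have im : (i < m)%N by rewrite (leq_trans (ltn_ord i)) ?leq_subr.
  have jm : (j + n < m)%N by rewrite addnC -ltn_subRL.
  rewrite (bigD1 (Ordinal im)) //= mxE eqxx mul1r big1 ?addr0; last first.
    by move=> b /eqP ne; rewrite mxE; case: eqP => [e|_]; rewrite ?mul0r //;
       case: ne; apply: val_inj.
  rewrite mxE (bigD1 (Ordinal jm)) //= [X in _ * X + _]mxE eqxx mulr1 big1 ?addr0.
    rewrite -[LHS](entry_ord _ (Ordinal im) (Ordinal jm)) entry_shiftX //.
    by rewrite eqn_add2r eq_sym.
  move=> b /eqP ne; rewrite [X in _ * X]mxE; case: eqP => [e|_]; rewrite ?mulr0 //.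
  by case: ne; apply: val_inj.
have [km|mk] := leqP k m; last first.
  apply/eqP; rewrite eqn_leq rank_geq andbT (eqP (ltnW mk)) leqn0 mxrank_eq0.
  apply/eqP/entryP=> i j im jm; rewrite entry_shiftX // ltn_eqF.
    by rewrite entry0.
  by rewrite (leq_trans jm) // (leq_trans (ltnW mk)) ?leq_addl.
apply/eqP; rewrite eqn_leq rank_geq andbT.
have /mulmx0_rank_max : shift_mx F m ^+ k *m shift_mx F m ^+ (m - k) = 0.
  rewrite -[_ *m _]exprD subnKC //; apply: entryP=> i j im jm.
  rewrite entry_shiftX // ltn_eqF ?(leq_trans jm) ?leq_addl //.
  by rewrite entry0.
have := rank_geq (m - k)%N; rewrite subKn // => ge le.
by rewrite leq_subRL // (leq_trans _ le) // addnC leq_add2l.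
Qed.

Lemma rank_jordanBX l a m k :
  \rank ((jordan_block l m - a%:M) ^+ k) = (if l == a then m - k else m)%N.
Proof.
case: eqVneq => [->|la].
  by rewrite jordan_blockE addrAC subrr add0r rank_shiftX.
apply: mxrank_unit; rewrite jordan_blockB.
elim: k => [|k IHk]; first exact: unitmx1.
by rewrite exprS unitmx_mul IHk unitmxE det_jordan_block unitrX // unitfE subr_eq0 la.
Qed.

End JordanRank.

(** * Involutions matching indices *)

Section MatchingInvolution.
Variables (I : finType) (T : eqType) (f : I -> T) (g : T -> T).
Hypothesis gK : involutive g.
Hypothesis card_fiber : forall x, #|[pred i | f i == g x]| = #|[pred i | f i == x]|.

(** The fibers over x and g x have equal cardinals: match their elements in
    enumeration order. Then f i = g (f i) makes i match itself. *)
Lemma matching_involution : exists tau : I -> I,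
  [/\ involutive tau, forall i, f (tau i) = g (f i)
    & forall i, g (f i) = f i -> tau i = i].
Proof.
pose fib x := enum [pred i | f i == x].
pose tau i := nth i (fib (g (f i))) (index i (fib (f i))).
have in_fib i : i \in fib (f i) by rewrite mem_enum inE.
have idx i : (index i (fib (f i)) < size (fib (g (f i))))%N.
  by rewrite -cardE card_fiber cardE index_mem in_fib.
have f_tau i : f (tau i) = g (f i).
  by apply/eqP; have := mem_nth i (idx i); rewrite mem_enum inE.
exists tau; split=> // [i|i gi].
  rewrite {1}/tau f_tau gK {2}/tau index_uniq ?enum_uniq //.
  by rewrite (set_nth_default i) ?nth_index // index_mem.
by rewrite /tau gi nth_index.
Qed.

End MatchingInvolution.

(** H picks one element in each orbit {i, tau i} of S; it does not depend on v, so
    that several sums can be compared on the same set of representatives. *)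
Lemma sum_free_involution (I : finType) (S : pred I) (tau : I -> I) :
    involutive tau -> (forall i, S (tau i) = S i) -> (forall i, S i -> tau i != i) ->
  exists H : pred I, forall v : I -> nat, (forall i, v (tau i) = v i) ->
    (\sum_(i | S i) v i = (\sum_(i | H i) v i).*2)%N.
Proof.
move=> tauK S_tau free.
pose less i := (enum_rank i < enum_rank (tau i))%N.
exists (fun i => S i && less i) => v v_tau.
rewrite -addnn (bigID less) /=; congr (_ + _)%N.
rewrite (reindex_inj (inv_inj tauK)) /=; apply: eq_big => [i|i _]; last exact: v_tau.
rewrite S_tau; case Si: (S i) => //=; rewrite /less tauK -leqNgt leq_eqVlt.
by rewrite (inj_eq val_inj) (inj_eq enum_rank_inj) eq_sym (negPf (free i Si)).
Qed.

(** * Decomposition along a family of blocks *)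

Section Splittings.
Variables (F : fieldType) (n k : nat) (m : 'I_k -> nat).
Implicit Types (U : forall i, 'M[F]_(m i, n)) (W : forall i, 'M[F]_(n, m i)).

(** A biproduct decomposition of F^n: U i is the projection to the i-th summand and
    W i its inclusion. Matrices indexed by blocks can then have any sizes m i,
    with no cast between n and their sum. *)
Record splitting U W : Prop := Splitting {
  split_id : forall i, U i *m W i = 1%:M;
  split_ortho : forall i j, i != j -> U i *m W j = 0;
  split_sum : \sum_i W i *m U i = 1%:M }.

Variables (U : forall i, 'M[F]_(m i, n)) (W : forall i, 'M[F]_(n, m i)).
Hypothesis UW : splitting U W.

(** X i carries the i-th summand to the one of index sigma i: a permutation sigma
    gives a block monomial matrix, and sigma = id a block diagonal one. *)
Definition blk (sigma : 'I_k -> 'I_k) (X : forall i, 'M[F]_(m (sigma i), m i)) :=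
  \sum_i W (sigma i) *m X i *m U i.

Lemma blk_mulW sigma X i : blk (sigma := sigma) X *m W i = W (sigma i) *m X i.
Proof.
rewrite mulmx_suml (bigD1 i) //= -mulmxA (split_id UW) mulmx1 big1 ?addr0 // => j ji.
by rewrite -mulmxA (split_ortho UW ji) mulmx0.
Qed.

Lemma mulU_blk (X : forall i, 'M[F]_(m i)) i : U i *m blk (sigma := id) X = X i *m U i.
Proof.
rewrite mulmx_sumr (bigD1 i) //= !mulmxA (split_id UW) mul1mx big1 ?addr0 // => j ji.
by rewrite !mulmxA (split_ortho UW) ?mul0mx // eq_sym.
Qed.

Lemma mul_blk sigma tau X Y :
  blk (sigma := sigma) X *m blk (sigma := tau) Y =
  blk (sigma := sigma \o tau) (fun i => X (tau i) *m Y i).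
Proof.
rewrite [X in _ *m X]/blk mulmx_sumr; apply: eq_bigr => i _.
by rewrite !mulmxA blk_mulW.
Qed.

Lemma blk_scalar a : blk (sigma := id) (fun i => a%:M) = a%:M.
Proof.
rewrite -[RHS]mulmx1 mul_scalar_mx -(split_sum UW) scaler_sumr.
by apply: eq_bigr => i _; rewrite mul_mx_scalar -scalemxAl.
Qed.

Lemma blkB sigma X Y :
  blk (sigma := sigma) (fun i => X i - Y i) = blk X - blk Y.
Proof.
by rewrite -sumrB; apply: eq_bigr => i _; rewrite mulmxBr mulmxBl.
Qed.

Lemma blkX (X : forall i, 'M[F]_(m i)) e :
  blk (sigma := id) X ^+ e = blk (sigma := id) (fun i => X i ^+ e).
Proof.
elim: e => [|e IHe]; first by rewrite [RHS]blk_scalar.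
rewrite exprS IHe [LHS]mul_blk; apply: eq_bigr => i _.
by rewrite /= exprS.
Qed.

(** Assembling U and W into square-by-blocks matrices shows that the operator and
    the block diagonal matrix of the X i factor through each other. *)
Lemma rank_blk (X : forall i, 'M[F]_(m i)) :
  \rank (blk (sigma := id) X) = (\sum_i \rank (X i))%N.
Proof.
rewrite -rank_mxdiag; set D := \mxdiag_i X i.
pose Wr := \mxrow_i W i; pose Uc := \mxcol_i U i.
have blkE : blk (sigma := id) X = Wr *m D *m Uc.
  by rewrite mul_mxrow_mxdiag mul_mxrow_mxcol.
have UcWr : Uc *m Wr = 1%:M.
  rewrite mul_mxcol_mxrow -mxdiagZ; apply/eq_mxblockP => i j.
  case: eqVneq => [->|/(split_ortho UW)->//].
  by rewrite (split_id UW) conform_mx_id.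
have DE : D = Uc *m blk (sigma := id) X *m Wr.
  by rewrite blkE !mulmxA UcWr mul1mx -mulmxA UcWr mulmx1.
apply/eqP; rewrite eqn_leq; apply/andP; split.
  by rewrite blkE -mulmxA (leq_trans (mxrankM_maxr _ _)) // mxrankM_maxl.
by rewrite DE -mulmxA (leq_trans (mxrankM_maxr _ _)) // mxrankM_maxl.
Qed.

Lemma split_size : (\sum_i m i)%N = n.
Proof.
rewrite -[RHS](mxrank1 F) -blk_scalar rank_blk.
by apply: eq_bigr => i _; rewrite mxrank1.
Qed.

Lemma split_trace (h : 'M[F]_n) : \tr h = \sum_i \tr (U i *m h *m W i).
Proof.
rewrite -{1}[h]mulmx1 -(split_sum UW) mulmx_sumr raddf_sum /=.
by apply: eq_bigr => i _; rewrite mulmxA mxtrace_mulC mulmxA.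
Qed.

End Splittings.
Arguments blk {F n k m} U W {sigma} X.

(** In A = P J P^-1, the columns of P cut along the blocks of J are the inclusions
    and the rows of P^-1 the projections. *)
Lemma jordan_splitting (F : fieldType) n (A : 'M[F]_n) js :
    jordan_decomposition A js ->
  exists (U : forall i, 'M[F]_(jordan_size i, n)) (W : forall i, 'M[F]_(n, jordan_size i)),
    splitting U W /\
    A = blk U W (sigma := id)
          (fun i : 'I_(size js) => jordan_block (tnth (in_tuple js) i).1 (jordan_size i)).
Proof.
case=> _ [e [P [Pu ->]]]; case: n / e P Pu A => P Pu _; rewrite castmx_id.
exists (fun i => submxcol (invmx P) i), (fun i => submxrow P i).
have UW i j : submxcol (invmx P) i *m submxrow P j = submxblock 1%:M i j.
  by rewrite submxblockEh -(mulVmx Pu) -mul_submxrow -submxcol_mul.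
split; first split.
- by move=> i; rewrite UW -mxdiagZ submxblock_diag.
- by move=> i j ij; rewrite UW -mxdiagZ mxblockK (negPf ij).
- by rewrite -mul_mxrow_mxcol submxrowK submxcolK mulmxV.
rewrite /blk -mul_mxrow_mxcol submxcolK; congr (_ *m _).
by rewrite -mul_mxrow_mxdiag submxrowK.
Qed.

(** * Reversing a matrix in Jordan form *)

(** Since A h (A - a^-1) = - a^-1 (A - a) h, induction gives
    A^k h (A - a^-1)^k = (- a^-1)^k (A - a)^k h, where A and h are invertible. *)
Lemma reverser_rank (F : fieldType) n (A h : 'M[F]_n) a k :
    a != 0 -> A \in unitmx -> h \in unitmx -> A *m h *m A = h ->
  \rank ((A - (a^-1)%:M) ^+ k) = \rank ((A - a%:M) ^+ k).
Proof.
move=> a0 Au hu AhA; set Y := A - _; set X := A - _.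
have Auk e : A ^+ e \in unitmx.
  elim: e => [|e IHe]; first exact: unitmx1.
  by rewrite exprS unitmx_mul Au.
have step : A *m h *m Y = - a^-1 *: (X *m h).
  rewrite mulmxBr AhA mulmxBl scalerBr mul_scalar_mx scalerA mulNr mulVf //.
  by rewrite mul_mx_scalar scaleN1r opprK addrC scaleNr.
have AX e : A ^+ e *m X = X *m A ^+ e.
  rewrite mulmxBr mulmxBl; congr (_ - _); last by rewrite mul_scalar_mx mul_mx_scalar.
  by rewrite -[LHS]exprSr -[RHS]exprS.
have {step} key : A ^+ k *m h *m Y ^+ k = (- a^-1) ^+ k *: (X ^+ k *m h).
  elim: k => [|k IHk]; first by rewrite scale1r mulmx1.
  have -> : A ^+ k.+1 *m h *m Y ^+ k.+1 = A ^+ k *m (A *m h *m Y) *m Y ^+ k.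
    by rewrite (exprSr A) (exprS Y) -[_ * A]/(_ *m A) -[Y * _]/(Y *m _) !mulmxA.
  rewrite step -scalemxAr -scalemxAl mulmxA AX -2!(mulmxA X) IHk.
  by rewrite -scalemxAr scalerA -exprS (exprS X) -mulmxA.
have ak : (- a^-1) ^+ k != 0 by rewrite expf_neq0 // oppr_eq0 invr_eq0.
have /(congr1 mxrank) := key.
rewrite mxrank_scale_nz // (mxrankMfree (X ^+ k)) ?row_free_unit // => <-.
rewrite -[RHS]mxrank_tr trmx_mul mxrankMfree ?mxrank_tr //.
by rewrite row_free_unit unitmx_tr unitmx_mul Auk.
Qed.

Section ReversibleSplitting.
Variables (F : fieldType) (n k : nat) (m : 'I_k -> nat) (l : 'I_k -> F).
Variables (U : forall i, 'M[F]_(m i, n)) (W : forall i, 'M[F]_(n, m i)).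
Variable A : 'M[F]_n.
Hypotheses (UW : splitting U W) (m_gt0 : forall i, (0 < m i)%N).
Hypothesis A_blk : A = blk U W (sigma := id) (fun i => jordan_block (l i) (m i)).

Lemma mulU_jordan i : U i *m A = jordan_block (l i) (m i) *m U i.
Proof. by rewrite A_blk mulU_blk. Qed.

Lemma mul_jordanW i : A *m W i = W i *m jordan_block (l i) (m i).
Proof. by rewrite A_blk blk_mulW. Qed.

Lemma jordan_eigen_neq0 : A \in unitmx -> forall i, l i != 0.
Proof.
move=> Au i; have : jordan_block (l i) (m i) *m (U i *m invmx A *m W i) = 1%:M.
  by rewrite !mulmxA -mulU_jordan -(mulmxA (U i)) mulmxV // mulmx1 (split_id UW).
move/mulmx1_unit => [+ _]; rewrite unitmxE det_jordan_block unitfE.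
by rewrite expf_eq0 m_gt0.
Qed.

(** Passing from the power e to e + 1 lowers the rank by one for each block at a
    of size larger than e. *)
Lemma card_larger_blocks a e :
  (\rank ((A - a%:M) ^+ e) =
   \rank ((A - a%:M) ^+ e.+1) + #|[pred i | (l i == a) && (e < m i)%N]|)%N.
Proof.
have rankE d : \rank ((A - a%:M) ^+ d) = (\sum_i if l i == a then m i - d else m i)%N.
  rewrite A_blk -(blk_scalar UW) -(blkB U W (sigma := id)) (blkX UW) (rank_blk UW).
  by apply: eq_bigr => i _; apply: rank_jordanBX.
rewrite !rankE -sum1_card [X in (_ + X)%N]big_mkcond -big_split /=.
apply: eq_bigr => i _; rewrite inE; case: (l i == a) => /=; last by rewrite addn0.
by case: ltnP => [lt|le]; [rewrite addn1 -subSn // subSS | rewrite addn0 subnS (eqP le)].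
Qed.

Lemma card_exact_blocks a e :
  (#|[pred i | (l i == a) && (e < m i)%N]| =
   #|[pred i | (l i, m i) == (a, e.+1)]| + #|[pred i | (l i == a) && (e.+1 < m i)%N]|)%N.
Proof.
rewrite -!sum1_card [LHS]big_mkcond [X in (X + _)%N]big_mkcond.
rewrite [X in (_ + X)%N]big_mkcond -big_split /=.
apply: eq_bigr => i _; rewrite !inE xpair_eqE.
by case: (l i == a); case: (ltngtP (m i) e.+1).
Qed.

(** The numbers of blocks of each size at a and at a^-1 agree by reverser_rank, so
    the blocks can be matched. *)
Lemma reversible_block_involution h : A \in unitmx -> h \in unitmx ->
    A *m h *m A = h ->
  exists tau : 'I_k -> 'I_k, [/\ involutive tau, forall i, l (tau i) = (l i)^-1,
    forall i, m (tau i) = m i & forall i, (l i)^-1 = l i -> tau i = i].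
Proof.
move=> Au hu AhA; pose f i := (l i, m i).
pose g (x : F * nat) := (x.1^-1, x.2).
have [] := @matching_involution _ _ f g.
- by move=> [x y]; rewrite /g /= invrK.
- move=> [a [|e]]; rewrite {}/f {}/g /=.
    by rewrite !eq_card0 // => i; rewrite !inE xpair_eqE [m i == _]gtn_eqF ?andbF.
  have [->|a0] := eqVneq a 0; first by rewrite invr0.
  have larger d : #|[pred i | (l i == a^-1) && (d < m i)%N]| =
                  #|[pred i | (l i == a) && (d < m i)%N]|.
    have := card_larger_blocks a^-1 d.
    rewrite !(reverser_rank _ a0 Au hu AhA) card_larger_blocks.
    by move/addnI.
  by have := card_exact_blocks a^-1 e; rewrite !larger card_exact_blocks => /addIn.
move=> tau [tauK f_tau fix_tau]; exists tau; split=> // i.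
- by have [] := f_tau i.
- by have [] := f_tau i.
- by move=> li; apply: fix_tau; rewrite /g /f /= li.
Qed.

(** Only the diagonal blocks of h contribute to its trace, and each is fixed by
    c |-> J c J. *)
Lemma reverser_trace0 (h : 'M[F]_n) : A *m h *m A = h ->
  (forall i, pm1 (l i) -> ~~ odd (m i)) -> \tr h = 0.
Proof.
move=> AhA even_pm1; rewrite (split_trace UW) big1 // => i _.
set c := U i *m h *m W i.
have cE : jordan_block (l i) (m i) *m c *m jordan_block (l i) (m i) = c.
  by rewrite /c !mulmxA -mulU_jordan -!mulmxA -mul_jordanW !mulmxA -(mulmxA _ A h)
     -(mulmxA _ (A *m h)) AhA.
case: (boolP (pm1 (l i))) => [li|li].
  apply: jordan_fixed_tr0 (even_pm1 i li) cE.
  by apply/eqP; rewrite -expr2 sqrf_eq1.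
by rewrite (jordan_fixed_eq0 _ cE) ?mxtrace0 // -expr2 sqrf_eq1.
Qed.

Variable tau : 'I_k -> 'I_k.
Hypotheses (tauK : involutive tau) (l_tau : forall i, l (tau i) = (l i)^-1).
Hypotheses (m_tau : forall i, m (tau i) = m i) (l_neq0 : forall i, l i != 0).

(** The signs eps leave room to adjust the determinant. *)
Definition swap_reverser (eps : 'I_k -> F) : 'M[F]_n :=
  blk U W (sigma := tau) (fun i => eps i *: pascal_mx (l i) (m (tau i)) (m i)).

Lemma swap_reverser_involution eps :
    (forall i, eps (tau i) = eps i) -> (forall i, eps i * eps i = 1) ->
  swap_reverser eps *m swap_reverser eps = 1%:M.
Proof.
move=> eps_tau eps2; rewrite (mul_blk UW) -(split_sum UW); apply: eq_bigr => i _.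
rewrite /= -scalemxAl -(scalemxAr (eps i)) scalerA eps_tau eps2 scale1r l_tau /=.
rewrite pascal_mxK ?m_tau //.
have := tauK i; move: (tau (tau i)) => j ->; congr (_ *m _).
rewrite -[RHS]mulmx1; congr (_ *m _); apply/matrixP => x y.
by rewrite !mxE.
Qed.

Lemma swap_reverser_reverses eps :
  A *m swap_reverser eps *m A = swap_reverser eps.
Proof.
rewrite A_blk !(mul_blk UW); apply: eq_bigr => i _ /=; congr (_ *m _ *m _).
by rewrite -scalemxAr -scalemxAl l_tau pascal_mx_reverses ?m_tau.
Qed.

(** Changing the sign on the block i0 is multiplying by 1 - 2 W U, where U W = 1
    has size m i0. *)
Lemma swap_reverser_flip i0 : tau i0 = i0 ->
  \det (swap_reverser (fun i => (-1) ^+ (i == i0))) =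
    (-1) ^+ m i0 * \det (swap_reverser (fun=> 1)).
Proof.
move=> tau_i0; set h := swap_reverser (fun=> 1).
have -> : swap_reverser (fun i => (-1) ^+ (i == i0)) =
          h *m (1%:M - (2%:R *: W i0) *m U i0).
  rewrite mulmxBr mulmx1 mulmxA -scalemxAr (blk_mulW UW) scale1r -scalemxAl.
  rewrite /h /swap_reverser /blk !(bigD1 (P := predT) i0) //= eqxx scale1r.
  rewrite addrAC; congr (_ + _); last first.
    by apply: eq_bigr => i /negPf->.
  by rewrite expr1 scaleN1r mulmxN mulNmx scaler_nat mulr2n opprD addrA subrr add0r.
rewrite det_mulmx det_1subM -scalemxAr (split_id UW) mulrC; congr (_ * _).
rewrite -[1%:M in X in X - _]scale1r -scalerBl detZ det1 mulr1.
by rewrite mulr2n opprD addNKr.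
Qed.

End ReversibleSplitting.

(** * The criterion *)

Lemma odd_sum_congr (I : finType) (P : pred I) (v w : I -> nat) :
  (forall i, P i -> odd (v i) = odd (w i)) ->
  odd (\sum_(i | P i) v i) = odd (\sum_(i | P i) w i).
Proof.
move=> vw; elim/big_ind2: _ => // x1 x2 y1 y2 ex ey.
by rewrite !oddD ex ey.
Qed.

(** Modulo 2, half the size of a block in S is 1 exactly when the size is 2
    modulo 4. Outside S the blocks come in pairs of equal size m, and half of the
    total size of a pair is m. *)
Lemma half_size_parity (I : finType) (m : I -> nat) (S : pred I) (tau : I -> I) :
    involutive tau -> (forall i, S (tau i) = S i) -> (forall i, ~~ S i -> tau i != i) ->
    (forall i, m (tau i) = m i) -> (forall i, S i -> ~~ odd (m i)) ->
  exists d, (\sum_i m i)%N = d.*2 /\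
    odd d = odd (#|[pred i | S i && (m i %% 4 == 2)%N]| +
                 #|[pred i | ~~ S i && odd (m i)]|./2).
Proof.
move=> tauK S_tau free m_tau even_S.
have [|H dblH] := sum_free_involution (S := fun i => ~~ S i) tauK _ free.
  by move=> i; rewrite S_tau.
exists (\sum_(i | S i) (m i)./2 + \sum_(i | H i) m i)%N; split.
  rewrite doubleD -dblH // -mul2n big_distrr /= (bigID S) /=; congr (_ + _)%N.
  by apply: eq_bigr => i Si; rewrite mul2n -[LHS]odd_double_half (negPf (even_S i Si)).
have -> : #|[pred i | ~~ S i && odd (m i)]| = (\sum_(i | H i) odd (m i)).*2%N.
  rewrite -(dblH (fun i => odd (m i) : nat)) => [|i]; last by rewrite m_tau.
  rewrite -sum1_card big_mkcond [RHS]big_mkcond; apply: eq_bigr => i _.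
  by rewrite inE; case: (S i); case: (odd (m i)).
have -> : #|[pred i | S i && (m i %% 4 == 2)%N]| =
          (\sum_(i | S i) (m i %% 4 == 2))%N.
  rewrite -sum1_card big_mkcond [RHS]big_mkcond; apply: eq_bigr => i _.
  by rewrite inE; case: (S i) => //=; case: (_ == _).
rewrite doubleK !oddD; congr (_ (+) _); apply: odd_sum_congr => i; last by rewrite oddb.
move/even_S => m_even; rewrite oddb -[in RHS](odd_double_half (m i)) (negPf m_even).
by rewrite add0n -mul2n -[4%N]/(2 * 2)%N -muln_modr modn2; case: odd.
Qed.

(** If A = h1 h2 with involutions h1 and h2, then h2 reverses A; conversely
    A = (A h) h. *)
Lemma strongly_reversibleP n (F : fieldType) (A : SL n F) :
  strongly_reversible A <->
  exists h : 'M[F]_n, [/\ h *m h = 1%:M, (A : 'M_n) *m h *m A = h & \det h = 1].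
Proof.
split=> [[h1 [h2 [/(congr1 val)/= h1h1 /(congr1 val)/= h2h2 ->]]]|].
  exists h2; split=> //=; last exact: det_SL.
  by rewrite -!mulmxA (mulmxA (h2 : 'M_n) (h2 : 'M_n)) h2h2 mul1mx mulmxA h1h1 mul1mx.
case=> h [hh AhA deth].
have Sh : \det h == 1 by rewrite deth.
have SAh : \det ((A : 'M_n) *m h) == 1 by rewrite det_mulmx deth det_SL mulr1.
exists (MkSL SAh), (MkSL Sh); split; apply: val_inj => //=.
  by rewrite mulmxA AhA.
by rewrite -mulmxA hh mulmx1.
Qed.

Lemma reversible_mx n (F : fieldType) (A : SL n F) : reversible A ->
  exists2 h : 'M[F]_n, h \in unitmx & (A : 'M_n) *m h *m A = h.
Proof.
case=> h hAh; exists (h : 'M_n); first exact: SL_unitmx.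
suff /(congr1 val) : (A * h * A = h)%g by [].
have hA : (h * A = A^-1 * h)%g by rewrite -hAh mulgKV.
by rewrite -mulgA hA mulKVg.
Qed.

Lemma count_tnth (T : eqType) (P : pred T) (s : seq T) :
  count P s = #|[pred i | P (tnth (in_tuple s) i)]|.
Proof. by rewrite -sum1_count big_tnth -sum1_card. Qed.

(** Either all reversing involutions have the determinant given by s + t, or a
    block of odd size at 1 or -1 makes both determinants occur. *)
Lemma strongly_reversible_SL_criterion (F : numFieldType) (n : nat) (A : SL n F)
    (js : seq (F * nat)) (s t : nat) :
  reversible A ->
  jordan_decomposition (A : 'M[F]_n) js ->
  s = num_pm1_2mod4 js ->
  t = num_odd_pairs js ->
  strongly_reversible A <->
    ((exists (mu : F) (r : nat),
        (mu = 1 \/ mu = -1) /\ (mu, (2 * r + 1)%N) \in js)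
     \/ (s + t = 0 %[mod 2])%N).
Proof.
move=> revA decA -> ->.
have js_gt0 := proj1 decA.
have [U [W [UW A_blk]]] := jordan_splitting decA.
pose l (i : 'I_(size js)) := (tnth (in_tuple js) i).1.
have m_gt0 (i : 'I_(size js)) : (0 < jordan_size i)%N.
  by apply: (allP js_gt0); apply: mem_tnth.
have [h0 h0u Ah0A] := reversible_mx revA.
have l0 : forall i, l i != 0 := jordan_eigen_neq0 UW m_gt0 A_blk (SL_unitmx A).
have [tau [tauK l_tau m_tau fix_tau]] : exists tau : 'I_(size js) -> 'I_(size js),
    [/\ involutive tau, forall i, l (tau i) = (l i)^-1,
       forall i, jordan_size (tau i) = jordan_size i
     & forall i, (l i)^-1 = l i -> tau i = i] :=
  reversible_block_involution UW m_gt0 A_blk (SL_unitmx A) h0u Ah0A.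
have pm1V a : pm1 a -> a^-1 = a :> F.
  by case/orP=> /eqP->; rewrite ?invrN invr1.
have pm1_tau i : pm1 (l (tau i)) = pm1 (l i).
  by rewrite l_tau; apply/idP/idP => [/[dup]/pm1V|/[dup]/pm1V->//]; rewrite invrK => <-.
have free_tau i : ~~ pm1 (l i) -> tau i != i.
  apply: contra => /eqP ti; have := l_tau i; rewrite ti => li.
  by rewrite /pm1 -sqrf_eq1 expr2 {2}li mulfV.
have nz2 : 2%:R != 0 :> F by rewrite pnatr_eq0.
have det_pm1 (h : 'M[F]_n) : (forall i, pm1 (l i) -> ~~ odd (jordan_size i)) ->
    h *m h = 1%:M -> (A : 'M_n) *m h *m A = h ->
    \det h = (-1) ^+ odd (num_pm1_2mod4 js + num_odd_pairs js).
  move=> even_pm1 hh AhA.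
  have [d [trh ->]] := det_involution nz2 hh.
  move: trh; rewrite (reverser_trace0 UW A_blk AhA even_pm1) add0r.
  move/eqP; rewrite eqr_nat => /eqP dn; rewrite -signr_odd; congr (_ ^+ _).
  have [e [sum_m odd_e]] := half_size_parity tauK pm1_tau free_tau m_tau even_pm1.
  have -> : d = e by apply: double_inj; rewrite dn -sum_m (split_size UW).
  by rewrite odd_e /num_pm1_2mod4 /num_odd_pairs !count_tnth.
have [/existsP[i0 /andP[pm1_i0 odd_i0]]|] :=
    boolP [exists i : 'I_(size js), pm1 (l i) && odd (jordan_size i)].
  split=> [_|_].
    left; exists (l i0), (jordan_size i0)./2; split.
      by case/orP: pm1_i0 => /eqP; [left | right].
    rewrite addnC mul2n -[1%N]/(nat_of_bool true) -odd_i0 odd_double_half.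
    by rewrite -[(_, _)]/(l i0, (tnth (in_tuple js) i0).2) -surjective_pairing mem_tnth.
  have tau_i0 : tau i0 = i0 by rewrite fix_tau // pm1V.
  pose h eps := swap_reverser l U W tau eps.
  have hh1 : h (fun=> 1) *m h (fun=> 1) = 1%:M.
    by apply: (swap_reverser_involution UW) => // i; rewrite mulr1.
  have hh2 : h (fun i => (-1) ^+ (i == i0)) *m h (fun i => (-1) ^+ (i == i0)) = 1%:M.
    apply: (swap_reverser_involution UW) => // i; last by rewrite -expr2 sqrr_sign.
    by rewrite -{1}tau_i0 (inj_eq (inv_inj tauK)).
  have flip := swap_reverser_flip l UW tau_i0.
  apply/strongly_reversibleP.
  have [d [_ det1]] := det_involution nz2 hh1.
  have [d_odd|d_even] := boolP (odd d); last first.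
    exists (h (fun=> 1)); split=> //; last by rewrite det1 -signr_odd (negPf d_even).
    exact: (swap_reverser_reverses UW A_blk).
  exists (h (fun i => (-1) ^+ (i == i0))); split=> //.
    exact: (swap_reverser_reverses UW A_blk).
  by rewrite flip -/(h _) det1 -signr_odd -[X in _ * X]signr_odd d_odd odd_i0 mulrNN mulr1.
rewrite negb_exists => /forallP no_odd.
have even_pm1 i : pm1 (l i) -> ~~ odd (jordan_size i).
  by move=> li; have := no_odd i; rewrite li.
split=> [/strongly_reversibleP[h [hh AhA]]|].
  rewrite (det_pm1 h) // => /eqP det1; right; rewrite modn2 mod0n.
  by move: det1; case: odd => //=; rewrite expr1 -subr_eq0 -opprD oppr_eq0 (negPf nz2).
case=> [[mu [r [mu1 /seq_tnthP[i i_js]]]]|].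
  have := even_pm1 i; rewrite /l /jordan_size -i_js /= addn1 mul2n /= odd_double.
  by move=> /(_ _)/negP[] //; case: mu1 => ->; rewrite /pm1 eqxx ?orbT.
rewrite modn2 mod0n => st; apply/strongly_reversibleP.
have hh : swap_reverser l U W tau (fun=> 1) *m swap_reverser l U W tau (fun=> 1) = 1%:M.
  by apply: (swap_reverser_involution UW) => // i; rewrite mulr1.
have AhA := swap_reverser_reverses UW A_blk l_tau m_tau l0 (fun=> 1).
exists (swap_reverser l U W tau (fun=> 1)); split=> //.
by rewrite det_pm1 //; case: odd st.
Qed.

Theorem theorem1p2 (R : realType) (n : nat) (A : SL n R[i])
    (js : seq (R[i] * nat)) (s t : nat) :
  reversible A ->
  jordan_decomposition (A : 'M[R[i]]_n) js ->
  s = num_pm1_2mod4 js ->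
  t = num_odd_pairs js ->
  strongly_reversible A <->
    ((exists (mu : R[i]) (r : nat),
        (mu = 1 \/ mu = -1) /\ (mu, (2 * r + 1)%N) \in js)
     \/ (s + t = 0 %[mod 2])%N).
Proof. exact: strongly_reversible_SL_criterion. Qed.
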